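(* Suppose that there are constants $0<c_1<c_2$ and $K>0$ such that for all (sufficiently large) $n$ there exists a linear triple system $H$ on $n$ vertices with $m$ edges, where $c_1n^{3/2}\le m\le c_2n^{3/2}$, with maximum degree at most $Kn^{1/2}$, with at most $Kn^{3/2}$ copies of $C_3$, and with at most $Kn^2$ copies of $C_k$ for each of $k=4,5$. Then the lower bound $m^6/n^7$ for the number of copies of $C_5$ in $n$-vertex linear triple systems with $m$ edges is tight in order of magnitude; that is, there is a constant $C>0$ such that for all integers $n,m$ with $C n^{3/2}\le m\le n^2/C$ there exists an $n$-vertex linear triple system with $m$ edges in which the number of copies of $C_5$ is at most $C\,m^6/n^7$.
   Context: A triple system (3-graph) consists of a finite vertex set and a set of 3-element subsets of it (edges). It is linear if every pair of vertices lies in at most one edge. The degree of a vertex is the number of edges containing it. The loose (linear) cycle $C_k$ ($k\ge 3$) is the triple system with $2k$ distinct vertices $v_1,\dots,v_k,w_1,\dots,w_k$ and the $k$ edges $\{v_i,v_{i+1},w_i\}$, $i=1,\dots,k$ (indices modulo $k$). A copy of $C_k$ in $H$ is a (not necessarily induced) subgraph of $H$ isomorphic to $C_k$. The lower bound referred to is: every $n$-vertex linear triple system ($n>10$) with $m>100\,n^{3/2}$ edges contains at least $m^6/n^7$ copies of $C_5$. *)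

(* Defs.v *)
From mathcomp Require Import all_boot.

Set Implicit Arguments.
Unset Strict Implicit.
Unset Printing Implicit Defensive.

(* A triple system on the vertex set V is given by its set of edges
   H : {set {set V}}; its number of edges is #|H|. *)
Section TripleSystems.
Variable V : finType.
Implicit Types H : {set {set V}}.

Definition triple_system H : bool := [forall e in H, #|e| == 3].

Definition linear_hypergraph H : bool :=
  [forall x, forall y, (x != y) ==>
    (#|[set e in H | (x \in e) && (y \in e)]| <= 1)].

Definition linear_triple_system H : bool :=
  triple_system H && linear_hypergraph H.

Definition degree H (v : V) : nat := #|[set e in H | v \in e]|.

Definition max_degree H : nat := \max_(v : V) degree H v.

End TripleSystems.

(* The vertex v_i is inl i and w_i is inr i, with indices shifted to start
   at 0; ordS is the successor modulo k. *)
Definition loose_cycle (k : nat) : {set {set 'I_k + 'I_k}} :=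
  [set [set inl i; inl (ordS i); inr i] | i : 'I_k].

Section Copies.
Variable V : finType.
Implicit Types (H : {set {set V}}) (S : {set V} * {set {set V}}).

(* A subgraph is a pair (vertex set, edge set); it need not be induced. *)
Definition subgraph S H : bool :=
  (S.2 \subset H) && [forall e in S.2, e \subset S.1].

(* S is isomorphic to the hypergraph G with vertex set U. *)
Definition isomorphic_to (U : finType) (G : {set {set U}}) S : bool :=
  [exists f : {ffun U -> V},
    [&& injectiveb f, S.1 == [set f x | x : U]
      & S.2 == [set [set f x | x in e] | e : {set U} in G]]].

Definition num_copies (U : finType) (G : {set {set U}}) H : nat :=
  #|[set S | subgraph S H && isomorphic_to G S]|.

End Copies.

(* Main.v *)
Require Import Defs.
From HB Require Import structures.
From mathcomp Require Import all_boot all_order all_algebra.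
From mathcomp Require Import all_classical all_reals all_analysis.
From mathcomp Require Import ring lra.

(** The extremal systems are blow-ups of the sparse system H given by the
    hypothesis. Replace each of the t vertices of H by a copy of a cyclic group
    of order s, and each edge abc of H by the s^2 triples (a,i), (b,j), (c,k)
    with i + j + k = 0. Any two coordinates determine the third, so the blow-up
    is linear; it has at least c1 t^(3/2) s^2 edges on ts vertices. With ts close
    to n this is n^2 / t^(1/2) up to a constant, so t is chosen of order
    n^4 / m^2, and m of the edges are kept.

    In a linear system a copy of C_5 is determined by the closed walk
    v_1, ..., v_5 in the shadow graph (two vertices are adjacent when some edge
    contains both), because each edge is determined by v_i and v_{i+1}. A closed
    walk of the blow-up projects to a closed walk of H, and each closed walk of
    H lifts in at most s^5 ways. So it suffices that H has O(t^2) closed walks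
    of length 5 in its shadow ([closed_walks5_bound]): the number of copies is
    then O(t^2 s^5) = O(n^5 / t^3) = O(m^6 / n^7).

    To bound the closed walks of length k = 3, 4, 5 in H, let w_i be the third
    vertex of the edge through x_i and x_{i+1}. If all the x_i and w_i are
    distinct, the walk traces a loose cycle C_k, and these are counted by
    hypothesis. Any coincidence among them folds the walk: up to rotation it is
    recovered from a shorter closed walk, together with at most one further
    vertex ranging over the O(t^(1/2)) neighbours of a known one (for k = 3 and
    for the backtracking 4-walks the shorter object is an adjacent pair). The
    folded walks therefore number O(t^(3/2)), O(t^2) and O(t^2) for
    k = 3, 4, 5 ([card_closed_walks3], [card_closed_walks4],
    [card_closed_walks5]). *)

Set Implicit Arguments.
Unset Strict Implicit.
Unset Printing Implicit Defensive.

Import Order.TTheory GRing.Theory Num.Theory.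

Local Open Scope nat_scope.

(** * Counting in finite types *)

Section Counting.

(** The shape of every degree bound below: [phi x] is what is left of a walk
    when the vertex [psi x] is forgotten, and it still determines a vertex
    [c x] to which [psi x] is adjacent. *)
Lemma leq_card_extension (T U V : finType) (A : {set T}) (B : {set U})
    (N : V -> {set V}) (phi : T -> U) (c psi : T -> V) (D : nat) :
  {in A, forall x, phi x \in B} -> {in A, forall x, psi x \in N (c x)} ->
  {in A &, forall x y, phi x = phi y -> c x = c y /\ (psi x = psi y -> x = y)} ->
  (forall v, #|N v| <= D) -> #|A| <= #|B| * D.
Proof.
move=> phiB psiN inj ND.
rewrite -sum1_card (partition_big phi (mem B)) /=; last exact: phiB.
rewrite -sum_nat_const; apply: leq_sum => u uB; rewrite sum1_card.
have [x0 /andP[x0A /eqP x0u]|no] := pickP [pred x in A | phi x == u]; last first.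
  by rewrite eq_card0.
apply: leq_trans (ND (c x0)); rewrite -(@card_in_imset _ _ psi).
  apply/subset_leq_card/fintype.subsetP => _ /imsetP[x + ->].
  rewrite unfold_in => /andP[xA /eqP xu].
  by have [<- _] := inj _ _ xA x0A (etrans xu (esym x0u)); exact: psiN.
move=> x y; rewrite !unfold_in => /andP[xA /eqP xu] /andP[yA /eqP yu].
by have [_] := inj _ _ xA yA (etrans xu (esym yu)).
Qed.

Lemma leq_card_inj (T U : finType) (A : {set T}) (B : {set U}) (phi : T -> U) :
  {in A, forall x, phi x \in B} -> {in A &, injective phi} -> #|A| <= #|B|.
Proof.
move=> phiB inj; rewrite -(card_in_imset inj).
by apply/subset_leq_card/fintype.subsetP => _ /imsetP[x xA ->]; exact: phiB.
Qed.

Lemma leq_card_bigcup (I T : finType) (J : {set I}) (F : I -> {set T})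
    (A : {set T}) (M : nat) :
  {in A, forall x, exists2 i, i \in J & x \in F i} ->
  {in J, forall i, #|F i| <= M} -> #|A| <= #|J| * M.
Proof.
move=> AF FM.
apply: (@leq_trans #|\bigcup_(i in J) F i|).
  apply/subset_leq_card/fintype.subsetP => x /AF[i iJ xF].
  by apply/bigcupP; exists i.
rewrite -sum_nat_const.
apply: (@leq_trans (\sum_(i in J) #|F i|)); last exact: leq_sum.
elim/big_rec2: _ => [|i n B _ Bn]; first by rewrite cards0.
by rewrite (leq_trans (leq_card_setU _ _)) // leq_add2l.
Qed.

Lemma leq_card_cases (T : finType) (A B : {set T}) (P : pred T) (m n : nat) :
  {in A, forall x, ~~ P x -> x \in B} -> #|[set x in A | P x]| <= m ->
  #|B| <= n -> #|A| <= m + n.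
Proof.
move=> AB Pm Bn; apply: leq_trans (leq_add Pm Bn).
apply: leq_trans (leq_card_setU _ _); apply/subset_leq_card/fintype.subsetP.
by move=> x xA; rewrite !inE xA /=; case: (boolP (P x)) => //= /AB; exact.
Qed.

Lemma leq_card_or (T : finType) (A : {set T}) (P Q : pred T) (m n : nat) :
  #|[set x in A | P x]| <= m -> #|[set x in A | Q x]| <= n ->
  #|[set x in A | P x || Q x]| <= m + n.
Proof.
move=> Pm Qn; apply: leq_trans (leq_add Pm Qn).
apply: leq_trans (leq_card_setU _ _); apply/subset_leq_card/fintype.subsetP.
by move=> x; rewrite !inE; case: (_ \in A).
Qed.

Lemma leq_card_exists (T : finType) (k : nat) (A : {set T})
    (P : 'I_k -> pred T) (M : nat) :
  (forall i, #|[set x in A | P i x]| <= M) ->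
  #|[set x in A | [exists i, P i x]]| <= k * M.
Proof.
move=> PM; rewrite -[k in k * _]card_ord -cardsT.
apply: (@leq_card_bigcup _ _ _ (fun i => [set x in A | P i x])) => // x.
by rewrite inE => /andP[xA /existsP[i Pix]]; exists i; rewrite !inE ?xA.
Qed.

End Counting.

(** * The shadow graph and loose cycles *)

Section Shadow.
Variables (V : finType) (H : {set {set V}}).

Definition shadow (x y : V) : bool := [exists z, [set x; y; z] \in H].

(** The default value [x] is only reached when the points are not adjacent. *)
Definition third (x y : V) : V := odflt x [pick z | [set x; y; z] \in H].

Definition closed_walks (k : nat) : {set k.-tuple V} :=
  [set x | [forall i, shadow (tnth x i) (tnth x (ordS i))]].

Lemma tripleCl (x y z : V) : [set x; y; z] = [set y; x; z].
Proof. by rewrite (finset.setUC [set x]). Qed.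

Lemma tripleCr (x y z : V) : [set x; y; z] = [set x; z; y].
Proof. by rewrite finset.setUAC. Qed.

Lemma shadowC x y : shadow x y -> shadow y x.
Proof. by case/existsP=> z; rewrite tripleCl => h; apply/existsP; exists z. Qed.

Lemma shadow12 x y z : [set x; y; z] \in H -> shadow x y.
Proof. by move=> h; apply/existsP; exists z. Qed.

Lemma shadow13 x y z : [set x; y; z] \in H -> shadow x z.
Proof. by rewrite tripleCr; exact: shadow12. Qed.

Lemma shadow23 x y z : [set x; y; z] \in H -> shadow y z.
Proof. by rewrite tripleCl; exact: shadow13. Qed.

Lemma thirdP x y : shadow x y -> [set x; y; third x y] \in H.
Proof.
case/existsP=> z h; rewrite /third; case: pickP => //= no.
by have := no z; rewrite h.
Qed.

Hypothesis linH : linear_triple_system H.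

Lemma edge_card e : e \in H -> #|e| = 3.
Proof. by case/andP: linH => /forallP/(_ e)/implyP h _ /h /eqP. Qed.

Lemma edge_unique e f x y :
  e \in H -> f \in H -> x != y -> x \in e -> y \in e -> x \in f -> y \in f ->
  e = f.
Proof.
move=> eH fH xy xe ye xf yf.
case/andP: linH => _ /forallP/(_ x)/forallP/(_ y)/implyP/(_ xy) /card_le1_eqP.
by apply; rewrite inE ?eH ?fH ?xe ?ye ?xf ?yf.
Qed.

Lemma triple_neq x y z : [set x; y; z] \in H -> [/\ x != y, y != z & x != z].
Proof.
move=> /edge_card; rewrite (finset.setUC [set x; y]) cardsU1 cards2 !inE negb_or.
by rewrite (eq_sym z x) (eq_sym z y); do 3 case: (_ != _).
Qed.

Lemma shadow_neq x y : shadow x y -> x != y.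
Proof. by case/existsP=> z /triple_neq[]. Qed.

Lemma triple_inj x y z z' :
  [set x; y; z] \in H -> [set x; y; z'] \in H -> z = z'.
Proof.
move=> h h'; have [xy yz xz] := triple_neq h.
have E : [set x; y; z] = [set x; y; z'].
  by apply: (edge_unique h h' xy); rewrite !inE eqxx ?orbT.
have : z \in [set x; y; z'] by rewrite -E !inE eqxx orbT.
by rewrite !inE eq_sym (negbTE xz) eq_sym (negbTE yz) => /eqP.
Qed.

Lemma triple_injl x x' y z :
  [set x; y; z] \in H -> [set x'; y; z] \in H -> x = x'.
Proof. 
rewrite (tripleCl x) (tripleCl x') (tripleCr y x) (tripleCr y x').
exact: triple_inj.
Qed.

Lemma triple_injm x y y' z :
  [set x; y; z] \in H -> [set x; y'; z] \in H -> y = y'.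
Proof. by rewrite (tripleCr x y) (tripleCr x y'); exact: triple_inj. Qed.

Lemma thirdE x y z : [set x; y; z] \in H -> third x y = z.
Proof. by move=> h; apply: triple_inj (thirdP (shadow12 h)) h. Qed.

Lemma third_neq x y : shadow x y -> third x y != x /\ third x y != y.
Proof.
by move/thirdP/triple_neq => [_ + +]; rewrite (eq_sym x) (eq_sym y) => -> ->.
Qed.

Lemma third_consecutive x y z :
  shadow x y -> shadow y z -> third x y = third y z -> x = z.
Proof.
move=> /thirdP hx /thirdP hz e; apply: triple_injl hx _.
by rewrite e tripleCl.
Qed.

Lemma card_shadow v : #|[set y | shadow v y]| <= 3 * max_degree H.
Proof.
apply: (@leq_trans (#|[set e in H | v \in e]| * 3)); last first.
  by rewrite mulnC leq_mul2l; exact: (leq_bigmax v).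
apply: (@leq_card_bigcup _ _ _ id) => [y|e]; rewrite !inE.
  case/existsP=> z h; exists [set v; y; z]; rewrite !inE ?h ?eqxx ?orbT //.
by case/andP=> /edge_card ->.
Qed.

Lemma closed_walksP k (x : k.-tuple V) :
  reflect (forall i, shadow (tnth x i) (tnth x (ordS i)))
          (x \in closed_walks k).
Proof. by rewrite inE; exact: forallP. Qed.

(** By linearity the edges of a copy, hence its vertices too, can be rebuilt from
    the images of the v_i alone; [copy] below is this reconstruction. *)
Lemma num_copies_closed_walks k :
  num_copies (loose_cycle k) H <= #|closed_walks k|.
Proof.
pose edge (p : V * V) := [set p.1; p.2; third p.1 p.2].
pose copy (x : k.-tuple V) :=
  (\bigcup_(i < k) edge (tnth x i, tnth x (ordS i)),
   [set edge (tnth x i, tnth x (ordS i)) | i : 'I_k]).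
rewrite /num_copies; apply: leq_trans (leq_imset_card copy _).
apply/subset_leq_card/fintype.subsetP => -[A E]; rewrite inE.
case/andP=> /andP[/= EH _].
case/existsP=> f /and3P[/injectiveP finj /eqP /= -> /eqP /= EE].
rewrite {}EE in EH *.
have fE i : f @: [set inl i; inl (ordS i); inr i]
    = [set f (inl i); f (inl (ordS i)); f (inr i)].
  by rewrite !imsetU !imset_set1.
have fH i : [set f (inl i); f (inl (ordS i)); f (inr i)] \in H.
  apply: (fintype.subsetP EH); apply/imsetP.
  by exists [set inl i; inl (ordS i); inr i]; rewrite ?fE //; apply: imset_f.
pose x := [tuple f (inl i) | i < k].
have eE i : edge (tnth x i, tnth x (ordS i))
    = [set f (inl i); f (inl (ordS i)); f (inr i)].
  by rewrite /edge !tnth_mktuple /= (thirdE (fH i)).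
apply/imsetP; exists x.
  by apply/closed_walksP => i; rewrite !tnth_mktuple; exact: shadow12 (fH i).
congr pair; apply/setP => v.
  apply/imsetP/bigcupP => [[[i|i] _ ->]|[i _]]; rewrite ?eE.
  - by exists i => //; rewrite eE !inE eqxx.
  - by exists i => //; rewrite eE !inE eqxx orbT.
  - by rewrite -fE => /imsetP[u _ ->]; exists u.
apply/imsetP/imsetP => [[_ /imsetP[i _ ->] ->]|[i _ ->]].
  by exists i => //; rewrite eE fE.
exists [set inl i; inl (ordS i); inr i]; rewrite ?eE ?fE //.
by apply: imset_f.
Qed.

(** The condition says that the vertices of the walk and the third vertices of
    its edges are 2k distinct points, so that the walk traces a loose cycle. *)
Definition loose_walks (k : nat) : {set k.-tuple V} :=
  [set x in closed_walks k |
    injectiveb (fun u : 'I_k + 'I_k =>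
      match u with
      | inl i => tnth x i
      | inr i => third (tnth x i) (tnth x (ordS i))
      end)].

(** All vertices of a loose walk lie in the copy that it traces, which has 2k
    vertices; so at most (2k)^k walks trace the same copy. *)
Lemma card_loose_walks k :
  #|loose_walks k| <= num_copies (loose_cycle k) H * (k + k) ^ k.
Proof.
pose F (S : {set V} * {set {set V}}) :=
  [set x : k.-tuple V | [forall i, tnth x i \in S.1]].
apply: (@leq_card_bigcup _ _ _ F) => [x|S].
  rewrite inE => /andP[/closed_walksP xw /injectiveP].
  set f := (fun u => _) => finj.
  pose f' := [ffun u => f u].
  exists ([set f' u | u : 'I_k + 'I_k],
    [set [set f' u | u in e] | e : {set _} in loose_cycle k]).
    rewrite inE; apply/andP; split; last first.
      apply/existsP; exists f'; rewrite !eqxx !andbT.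
      by apply/injectiveP => u v; rewrite !ffunE; exact: finj.
    apply/andP; split => /=; last first.
      apply/forallP => e; apply/implyP => /imsetP[e' _ ->].
      by apply/fintype.subsetP => _ /imsetP[u _ ->]; exact: imset_f.
    apply/fintype.subsetP => _ /imsetP[_ /imsetP[i _ ->] ->].
    by rewrite !imsetU !imset_set1 !ffunE; exact: thirdP (xw i).
  rewrite inE; apply/forallP => i; apply/imsetP; exists (inl i) => //.
  by rewrite ffunE.
rewrite inE => /andP[_ /existsP[f /and3P[_ /eqP S1 _]]].
have cS : #|S.1| <= k + k.
  by rewrite S1 (leq_trans (leq_imset_card _ _)) // card_sum !card_ord.
apply: (@leq_trans (#|S.1| ^ k)); last first.
  by have [k0|k0] := posnP k; [rewrite !k0 | rewrite leq_exp2r].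
rewrite -[k in _ ^ k]card_ord -card_ffun_on -[X in _ <= X]cardsE.
pose phi (x : k.-tuple V) := [ffun i => tnth x i].
apply: (@leq_card_inj _ _ _ _ phi) => [x|x y _ _].
  rewrite !inE => /forallP h; apply/ffun_onP => i; rewrite ffunE; exact: h.
by move/ffunP => h; apply: eq_from_tnth => i; have := h i; rewrite !ffunE.
Qed.

End Shadow.

(** * Closed walks of length 3, 4 and 5 *)

Section ShortWalks.
Variables (V : finType) (H : {set {set V}}).
Hypothesis linH : linear_triple_system H.

Local Notation sh := (shadow H).
Local Notation "x .[ i ]" := (tnth x i) : nat_scope.
Local Notation S := (@ordS _).
(* An upper bound for the degrees of the shadow graph. *)
Let D := 3 * max_degree H.

Lemma val_iter_ordS k n (i : 'I_k) : iter n S i = (i + n) %% k :> nat.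
Proof.
elim: n => [|n IHn]; first by rewrite addn0 modn_small.
by rewrite iterS /= IHn -addn1 modnDml addn1 addnS.
Qed.

Lemma iter_ordS_cycle k (i : 'I_k) : iter k S i = i.
Proof. by apply/val_inj; rewrite /= val_iter_ordS modnDr modn_small. Qed.

Lemma iter_ordS_onto k (i j : 'I_k) : exists2 n, n < k & j = iter n S i.
Proof.
exists ((j + (k - i)) %% k).
  by rewrite ltn_pmod // (leq_ltn_trans _ (ltn_ord i)).
apply/val_inj; rewrite /= val_iter_ordS modnDmr addnCA subnKC 1?ltnW //.
by rewrite modnDr modn_small.
Qed.

Lemma ordS3_cycle (i : 'I_3) : S (S (S i)) = i.
Proof. exact: iter_ordS_cycle. Qed.

Lemma ordS4_cycle (i : 'I_4) : S (S (S (S i))) = i.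
Proof. exact: iter_ordS_cycle. Qed.

Lemma ordS5_cycle (i : 'I_5) : S (S (S (S (S i)))) = i.
Proof. exact: iter_ordS_cycle. Qed.

Lemma ord3_cases (i j : 'I_3) : [\/ j = i, j = S i | j = S (S i)].
Proof. by case: (iter_ordS_onto i j) => -[|[|[|]]] // _ ->; constructor. Qed.

Lemma ord4_cases (i j : 'I_4) :
  [\/ j = i, j = S i, j = S (S i) | j = S (S (S i))].
Proof. by case: (iter_ordS_onto i j) => -[|[|[|[|]]]] // _ ->; constructor. Qed.

Lemma ord5_cases (i j : 'I_5) :
  [\/ j = i, j = S i, j = S (S i) | j = S (S (S i)) \/ j = S (S (S (S i)))].
Proof.
by case: (iter_ordS_onto i j) => -[|[|[|[|[|]]]]] // _ ->;
  do ?[by constructor]; apply: Or44; [left | right].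
Qed.

Lemma eq_walk3 i (x y : 3.-tuple V) : x.[i] = y.[i] -> x.[S i] = y.[S i] ->
  x.[S (S i)] = y.[S (S i)] -> x = y.
Proof.
by move=> ? ? ?; apply: eq_from_tnth => j; case: (ord3_cases i j) => ->.
Qed.

Lemma eq_walk4 i (x y : 4.-tuple V) : x.[i] = y.[i] -> x.[S i] = y.[S i] ->
  x.[S (S i)] = y.[S (S i)] -> x.[S (S (S i))] = y.[S (S (S i))] -> x = y.
Proof.
by move=> ? ? ? ?; apply: eq_from_tnth => j; case: (ord4_cases i j) => ->.
Qed.

Lemma eq_walk5 i (x y : 5.-tuple V) : x.[i] = y.[i] -> x.[S i] = y.[S i] ->
  x.[S (S i)] = y.[S (S i)] -> x.[S (S (S i))] = y.[S (S (S i))] ->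
  x.[S (S (S (S i)))] = y.[S (S (S (S i)))] -> x = y.
Proof.
move=> ? ? ? ? ?; apply: eq_from_tnth => j.
by case: (ord5_cases i j) => [->|->|->|[->|->]].
Qed.

Lemma closed_walk3 a b c : sh a b -> sh b c -> sh c a ->
  [tuple a; b; c] \in closed_walks H 3.
Proof.
move=> ab bc ca; apply/closed_walksP => -[[|[|[|]]]] // ?;
  by rewrite !(tnth_nth a) /=.
Qed.

Lemma closed_walk4 a b c d : sh a b -> sh b c -> sh c d -> sh d a ->
  [tuple a; b; c; d] \in closed_walks H 4.
Proof.
move=> ab bc cd da; apply/closed_walksP => -[[|[|[|[|]]]]] // ?;
  by rewrite !(tnth_nth a) /=.
Qed.

Lemma card_shadow_pairs : #|[set p : V * V | sh p.1 p.2]| <= #|V| * D.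
Proof.
rewrite -[X in X * _]cardsT.
apply: (@leq_card_extension _ _ _ _ _ (fun v => [set y | sh v y]) fst fst snd).
- by move=> p _; rewrite inE.
- by move=> p; rewrite !inE.
- by move=> [a b] [c d] _ _ /= ->; split=> // ->.
- by move=> v; exact: card_shadow.
Qed.

(** A closed walk of length 3 that is not a loose triangle lies inside a single
    edge, and its first two vertices determine it. *)
Lemma card_closed_walks3 :
  #|closed_walks H 3| <=
    3 * (#|V| * D) + num_copies (loose_cycle 3) H * (3 + 3) ^ 3.
Proof.
pose P i (x : 3.-tuple V) := [set x.[i]; x.[S i]; x.[S (S i)]] \in H.
apply: (leq_card_cases (B := loose_walks H 3) (P := fun x => [exists i, P i x])).
- move=> x xw /existsPn nP; rewrite inE xw /=; move/closed_walksP: xw => xw.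
  have e i := thirdP (xw i).
  have x_neq i : x.[i] != x.[S i] by apply: (shadow_neq linH (xw i)).
  have xx i j : x.[i] = x.[j] -> i = j.
    case: (ord3_cases i j) => -> // /eqP; first by rewrite (negbTE (x_neq i)).
    by rewrite eq_sym -{2}[i]ordS3_cycle (negbTE (x_neq (S (S i)))).
  have wx i j : third H x.[i] x.[S i] <> x.[j].
    have [wl wr] := third_neq linH (xw i).
    case: (ord3_cases i j) => -> h; rewrite ?h ?eqxx // in wl wr.
    by have /negP[] := nP i; rewrite /P -h.
  have ww1 i : third H x.[i] x.[S i] <> third H x.[S i] x.[S (S i)].
    move/(third_consecutive linH (xw i) (xw (S i))) => h.
    by have := x_neq (S (S i)); rewrite ordS3_cycle h eqxx.
  apply/injectiveP => -[i|i] [j|j].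
  + by move/xx ->.
  + by move=> /esym h; case: (wx j i).
  + by move=> h; case: (wx i j).
  + case: (ord3_cases i j) => -> // h; first by case: (ww1 i).
    by case: (ww1 (S (S i))); rewrite -h ordS3_cycle.
- apply: leq_card_exists => i; apply: leq_trans card_shadow_pairs.
  apply: (@leq_card_inj _ _ _ _ (fun x => (x.[i], x.[S i]))) => [x|x y].
    by rewrite !inE /= => /andP[/forallP].
  rewrite !inE => /andP[_ Px] /andP[_ Py] [e0 e1].
  apply: (@eq_walk3 i) => //; move: Px; rewrite /P e0 e1 => Px.
  exact: (triple_inj linH Px Py).
- exact: card_loose_walks.
Qed.

(** Up to rotation, a closed walk x0 x1 x2 x3 that is not loose falls under one
    of three cases: x0 = x2, leaving an adjacent pair and a further neighbour;
    w0 = w2, where x1 x2 w0 is a triangle that determines x0 and x3; x0 x1 x2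
    is an edge, where x0 x2 x3 is a triangle that determines x1. *)
Lemma card_closed_walks4 :
  #|closed_walks H 4| <=
    4 * (#|V| * D * D + (#|closed_walks H 3| + #|closed_walks H 3|))
    + num_copies (loose_cycle 4) H * (4 + 4) ^ 4.
Proof.
pose w i (x : 4.-tuple V) := third H x.[i] x.[S i].
pose P i (x : 4.-tuple V) := (x.[i] == x.[S (S i)]) ||
  ((w i x == w (S (S i)) x) || ([set x.[i]; x.[S i]; x.[S (S i)]] \in H)).
apply: (leq_card_cases (B := loose_walks H 4) (P := fun x => [exists i, P i x])).
- move=> x xw /existsPn nP; rewrite inE xw /=; move/closed_walksP: xw => xw.
  have x_neq i : x.[i] != x.[S i] by apply: (shadow_neq linH (xw i)).
  have nPa i : x.[i] != x.[S (S i)] by have := nP i; rewrite !negb_or => /and3P[].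
  have nPb i : w i x != w (S (S i)) x.
    by have := nP i; rewrite !negb_or => /and3P[].
  have nPc i : [set x.[i]; x.[S i]; x.[S (S i)]] \notin H.
    by have := nP i; rewrite !negb_or => /and3P[].
  have e i : [set x.[i]; x.[S i]; w i x] \in H := thirdP (xw i).
  (* None of the degenerate cases occurs, so all 2k points are distinct. *)
  have xx i j : x.[i] = x.[j] -> i = j.
    case: (ord4_cases i j) => -> // /eqP.
    + by rewrite (negbTE (x_neq i)).
    + by rewrite (negbTE (nPa i)).
    + by rewrite eq_sym -{2}[i]ordS4_cycle (negbTE (x_neq (S (S (S i))))).
  have wx i j : w i x <> x.[j].
    have [wl wr] : w i x != x.[i] /\ w i x != x.[S i] := third_neq linH (xw i).
    case: (ord4_cases i j) => -> h; rewrite ?h ?eqxx // in wl wr.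
    + by have /negP[] := nPc i; rewrite -h; apply: e.
    + have /negP[] := nPc (S (S (S i))).
      by rewrite ordS4_cycle -h tripleCl tripleCr; apply: e.
  have ww1 i : w i x <> w (S i) x.
    move/(third_consecutive linH (xw i) (xw (S i))) => h.
    by have := nPa i; rewrite h eqxx.
  apply/injectiveP => -[i|i] [j|j].
  + by move/xx ->.
  + by move=> /esym h; case: (wx j i).
  + by move=> h; case: (wx i j).
  + case: (ord4_cases i j) => -> //.
    * by move=> h; case: (ww1 i).
    * by move=> h; have := nPb i; rewrite /w h eqxx.
    * by move=> h; case: (ww1 (S (S (S i)))); rewrite /w -h ordS4_cycle.
- apply: leq_card_exists => i; apply: leq_card_or; last apply: leq_card_or.
  (* The walk backtracks at x1. *)
  + apply: leq_trans (leq_mul card_shadow_pairs (leqnn D)).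
    apply: (@leq_card_extension _ _ _ _ _ (fun v => [set y | sh v y])
      (fun x => (x.[i], x.[S i])) (fun x => x.[i])
      (fun x => x.[S (S (S i))])) => [x|x|x y|v].
    * by rewrite !inE /= => /andP[/forallP].
    * rewrite !inE => /andP[/forallP xw _]; apply: shadowC.
      by have := xw (S (S (S i))); rewrite ordS4_cycle.
    * rewrite !inE => /andP[_ /eqP Px] /andP[_ /eqP Py] [e0 e1].
      by split=> // e3; apply: (@eq_walk4 i) => //; rewrite -Px -Py.
    * exact: card_shadow.
  (* The first and third edges share their third vertex. *)
  + apply: (@leq_card_inj _ _ _ _
      (fun x => [tuple x.[S i]; x.[S (S i)]; w i x])) => [x|x y].
      rewrite inE => /andP[/closed_walksP xw /eqP Px].
      have ei := thirdP (xw i); have ei2 := thirdP (xw (S (S i))).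
      apply: closed_walk3; first exact: xw; last exact: shadowC (shadow23 ei).
      by rewrite Px; exact: shadow13 ei2.
    rewrite !inE => /andP[/forallP xw /eqP Px] /andP[/forallP yw /eqP Py].
    move/(congr1 val) => -[e1 e2 ew].
    have [hx hy] := (thirdP (xw i), thirdP (yw i)).
    have [hx2 hy2] := (thirdP (xw (S (S i))), thirdP (yw (S (S i)))).
    rewrite -!/(w _ _) in hx hy hx2 hy2.
    rewrite -Px ew e2 in hx2; rewrite -Py in hy2; rewrite ew e1 in hx.
    apply: (@eq_walk4 i) => //; first exact: (triple_injl linH hx hy).
    exact: (triple_injm linH hx2 hy2).
  (* The first and second edges coincide. *)
  + apply: (@leq_card_inj _ _ _ _
      (fun x => [tuple x.[i]; x.[S (S i)]; x.[S (S (S i))]])) => [x|x y].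
      rewrite inE => /andP[/closed_walksP xw Px].
      apply: closed_walk3; [exact: shadow13 Px | exact: xw |].
      by have := xw (S (S (S i))); rewrite ordS4_cycle.
    rewrite !inE => /andP[_ Px] /andP[_ Py] /(congr1 val) -[e0 e2 e3].
    apply: (@eq_walk4 i) => //; rewrite e0 e2 in Px.
    exact: (triple_injm linH Px Py).
- exact: card_loose_walks.
Qed.

(** Up to rotation, a closed walk x0 x1 x2 x3 x4 that is not loose falls under
    one of four cases. If x0 = x2, it is the triangle x0 x3 x4 with a neighbour
    x1 of x0. If x0 x1 x3 is an edge, the triangle x1 x2 x3 determines x0, and
    x4 is a neighbour of x3. If w0 = w2, the triangle x1 x2 w0 determines x0
    and x3, and x4 is a neighbour of x0. If x0 x1 x2 is an edge, the closed
    walk x0 x2 x3 x4 determines x1. *)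
Lemma card_closed_walks5 :
  #|closed_walks H 5| <=
    5 * (#|closed_walks H 3| * D + (#|closed_walks H 3| * D +
        (#|closed_walks H 3| * D + #|closed_walks H 4|)))
    + num_copies (loose_cycle 5) H * (5 + 5) ^ 5.
Proof.
pose w i (x : 5.-tuple V) := third H x.[i] x.[S i].
pose P i (x : 5.-tuple V) := (x.[i] == x.[S (S i)]) ||
  (([set x.[i]; x.[S i]; x.[S (S (S i))]] \in H) ||
  ((w i x == w (S (S i)) x) || ([set x.[i]; x.[S i]; x.[S (S i)]] \in H))).
apply: (leq_card_cases (B := loose_walks H 5) (P := fun x => [exists i, P i x])).
- move=> x xw /existsPn nP; rewrite inE xw /=; move/closed_walksP: xw => xw.
  have x_neq i : x.[i] != x.[S i] by apply: (shadow_neq linH (xw i)).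
  have nPa i : x.[i] != x.[S (S i)] by have := nP i; rewrite !negb_or => /and4P[].
  have nPb i : [set x.[i]; x.[S i]; x.[S (S (S i))]] \notin H.
    by have := nP i; rewrite !negb_or => /and4P[].
  have nPc i : w i x != w (S (S i)) x.
    by have := nP i; rewrite !negb_or => /and4P[].
  have nPd i : [set x.[i]; x.[S i]; x.[S (S i)]] \notin H.
    by have := nP i; rewrite !negb_or => /and4P[].
  have e i : [set x.[i]; x.[S i]; w i x] \in H := thirdP (xw i).
  (* None of the degenerate cases occurs, so all 2k points are distinct. *)
  have xx i j : x.[i] = x.[j] -> i = j.
    case: (ord5_cases i j) => [->|->|->|[->|->]] // /eqP.
    + by rewrite (negbTE (x_neq i)).
    + by rewrite (negbTE (nPa i)).
    + by rewrite eq_sym -{2}[i]ordS5_cycle (negbTE (nPa (S (S (S i))))).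
    + by rewrite eq_sym -{2}[i]ordS5_cycle (negbTE (x_neq (S (S (S (S i)))))).
  have wx i j : w i x <> x.[j].
    have [wl wr] : w i x != x.[i] /\ w i x != x.[S i] := third_neq linH (xw i).
    case: (ord5_cases i j) => [->|->|->|[->|->]] h; rewrite ?h ?eqxx // in wl wr.
    + by have /negP[] := nPd i; rewrite -h; apply: e.
    + by have /negP[] := nPb i; rewrite -h; apply: e.
    + have /negP[] := nPd (S (S (S (S i)))).
      by rewrite ordS5_cycle -h tripleCl tripleCr; apply: e.
  have ww1 i : w i x <> w (S i) x.
    move/(third_consecutive linH (xw i) (xw (S i))) => h.
    by have := nPa i; rewrite h eqxx.
  apply/injectiveP => -[i|i] [j|j].
  + by move/xx ->.
  + by move=> /esym h; case: (wx j i).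
  + by move=> h; case: (wx i j).
  + case: (ord5_cases i j) => [->|->|->|[->|->]] //.
    * by move=> h; case: (ww1 i).
    * by move=> h; have := nPc i; rewrite /w h eqxx.
    * by move=> h; have := nPc (S (S (S i))); rewrite /w -h ordS5_cycle eqxx.
    * by move=> h; case: (ww1 (S (S (S (S i))))); rewrite /w -h ordS5_cycle.
- apply: leq_card_exists => i; apply: leq_card_or; last apply: leq_card_or;
    last apply: leq_card_or.
  (* The walk backtracks at x1. *)
  + apply: (@leq_card_extension _ _ _ _ _ (fun v => [set y | sh v y])
      (fun x => [tuple x.[i]; x.[S (S (S i))]; x.[S (S (S (S i)))]])
      (fun x => x.[i]) (fun x => x.[S i])) => [x|x|x y|v].
    * rewrite inE => /andP[/closed_walksP xw /eqP Px].
      apply: closed_walk3; [by rewrite Px; exact: xw | exact: xw |].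
      by have := xw (S (S (S (S i)))); rewrite ordS5_cycle.
    * by rewrite !inE => /andP[/forallP xw _].
    * rewrite !inE => /andP[_ /eqP Px] /andP[_ /eqP Py].
      move/(congr1 val) => -[e0 e3 e4].
      by split=> // e1; apply: (@eq_walk5 i) => //; rewrite -Px -Py.
    * exact: card_shadow.
  (* The first edge passes through the opposite vertex x3. *)
  + apply: (@leq_card_extension _ _ _ _ _ (fun v => [set y | sh v y])
      (fun x => [tuple x.[S i]; x.[S (S i)]; x.[S (S (S i))]])
      (fun x => x.[S (S (S i))]) (fun x => x.[S (S (S (S i)))])) => [x|x|x y|v].
    * rewrite inE => /andP[/closed_walksP xw Px].
      apply: closed_walk3; [exact: xw | exact: xw |].
      exact: shadowC (shadow23 Px).
    * by rewrite !inE => /andP[/forallP xw _].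
    * rewrite !inE => /andP[_ Px] /andP[_ Py].
      move/(congr1 val) => -[e1 e2 e3]; split=> // e4.
      apply: (@eq_walk5 i) => //; rewrite e1 e3 in Px.
      exact: (triple_injl linH Px Py).
    * exact: card_shadow.
  (* The first and third edges share their third vertex. *)
  + apply: (@leq_card_extension _ _ _ _ _ (fun v => [set y | sh v y])
      (fun x => [tuple x.[S i]; x.[S (S i)]; w i x])
      (fun x => x.[i]) (fun x => x.[S (S (S (S i)))])) => [x|x|x y|v].
    * rewrite inE => /andP[/closed_walksP xw /eqP Px].
      have ei := thirdP (xw i); have ei2 := thirdP (xw (S (S i))).
      apply: closed_walk3; first exact: xw; last exact: shadowC (shadow23 ei).
      by rewrite Px; exact: shadow13 ei2.
    * rewrite !inE => /andP[/forallP xw _]; apply: shadowC.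
      by have := xw (S (S (S (S i)))); rewrite ordS5_cycle.
    * rewrite !inE => /andP[/forallP xw /eqP Px] /andP[/forallP yw /eqP Py].
      move/(congr1 val) => -[e1 e2 ew].
      have [hx hy] := (thirdP (xw i), thirdP (yw i)).
      have [hx2 hy2] := (thirdP (xw (S (S i))), thirdP (yw (S (S i)))).
      rewrite -!/(w _ _) in hx hy hx2 hy2.
      rewrite -Px ew e2 in hx2; rewrite -Py in hy2; rewrite ew e1 in hx.
      have e0 := triple_injl linH hx hy; split=> // e4.
      by apply: (@eq_walk5 i) => //; exact: (triple_injm linH hx2 hy2).
    * exact: card_shadow.
  (* The first and second edges coincide. *)
  + apply: (@leq_card_inj _ _ _ _ (fun x => [tuple x.[i]; x.[S (S i)];
      x.[S (S (S i))]; x.[S (S (S (S i)))]])) => [x|x y].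
      rewrite inE => /andP[/closed_walksP xw Px].
      apply: closed_walk4; [exact: shadow13 Px | exact: xw | exact: xw |].
      by have := xw (S (S (S (S i)))); rewrite ordS5_cycle.
    rewrite !inE => /andP[_ Px] /andP[_ Py] /(congr1 val) -[e0 e2 e3 e4].
    apply: (@eq_walk5 i) => //; rewrite e0 e2 in Px.
    exact: (triple_injm linH Px Py).
- exact: card_loose_walks.
Qed.

End ShortWalks.

(** * Blowing up a linear triple system *)

Section BlowUp.
Variables (V W : finType) (G : finZmodType) (g : V * G -> W).
Variable H : {set {set V}}.
Hypothesis g_inj : injective g.
Hypothesis linH : linear_triple_system H.

Local Notation lift3 a b c i j :=
  [set g (a, i); g (b, j); g (c, - (i + j))%R].

(** The vertex [g (a, i)] is the i-th copy of a. The zero-sum condition defining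
    the edges is symmetric, so the result depends on no ordering of the edges
    of [H]; the injection [g] leaves room for isolated vertices. *)
Definition blowup : {set {set W}} :=
  [set lift3 p.1.1.1 p.1.1.2 p.1.2 p.2.1 p.2.2
    | p : V * V * V * (G * G) in
      [set p : V * V * V * (G * G) | [set p.1.1.1; p.1.1.2; p.1.2] \in H]].

Lemma blowupP (E : {set W}) :
  reflect (exists a b c i j, [set a; b; c] \in H /\ E = lift3 a b c i j)
          (E \in blowup).
Proof.
apply: (iffP imsetP) => [[[[[a b] c] [i j]]]|[a [b [c [i [j [h ->]]]]]]].
  by rewrite inE /= => h ->; exists a, b, c, i, j.
by exists ((a, b, c), (i, j)); rewrite ?inE.
Qed.

(** By the symmetry of the zero-sum condition, any two points of an edge can be
    taken to be the first two. *)
Lemma blowup_pair (E : {set W}) x y :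
  E \in blowup -> x \in E -> y \in E -> x != y ->
  exists a b c i j, [/\ [set a; b; c] \in H, E = lift3 a b c i j,
    x = g (a, i) & y = g (b, j)].
Proof.
move=> /blowupP[a [b [c [i [j [h ->]]]]]].
have k2 : (- (i - (i + j)) = j)%R by rewrite opprB addrAC subrr add0r.
have k1 : (- (j - (i + j)) = i)%R by rewrite opprB addrK.
have h1 := h; rewrite tripleCr in h1.
have h2 := h; rewrite tripleCl in h2.
have h3 := h2; rewrite tripleCr in h3.
have h4 := h1; rewrite tripleCl in h4.
have h5 := h3; rewrite tripleCl in h5.
rewrite !inE => /orP[/orP[]|] /eqP -> /orP[/orP[]|] /eqP -> //;
  rewrite ?eqxx // => _.
- by exists a, b, c, i, j.
- by exists a, c, b, i, (- (i + j))%R; split=> //; rewrite k2 tripleCr.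
- by exists b, a, c, j, i; split=> //; rewrite (addrC j) tripleCl.
- exists b, c, a, j, (- (i + j))%R; split=> //.
  by rewrite k1 tripleCl tripleCr.
- exists c, a, b, (- (i + j))%R, i; split=> //.
  by rewrite (addrC (- _)%R) k2 tripleCr tripleCl.
- exists c, b, a, (- (i + j))%R, j; split=> //.
  by rewrite (addrC (- _)%R) k1 tripleCl tripleCr tripleCl.
Qed.

Lemma blowup_linear : linear_triple_system blowup.
Proof.
apply/andP; split.
  apply/forallP => E; apply/implyP => /blowupP[a [b [c [i [j [h ->]]]]]].
  have [ab bc ac] := triple_neq linH h.
  rewrite (finset.setUC [set _; _]) cardsU1 cards2 !inE !(inj_eq g_inj).
  rewrite !xpair_eqE.
  by rewrite (eq_sym c a) (eq_sym c b) (negbTE ab) (negbTE bc) (negbTE ac).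
apply/forallP => x; apply/forallP => y; apply/implyP => xy.
apply/card_le1_eqP => E F; rewrite !inE.
case/andP=> EH /andP[xE yE] /andP[FH /andP[xF yF]].
have [a [b [c [i [j [h -> xai ybj]]]]]] := blowup_pair EH xE yE xy.
have [a' [b' [c' [i' [j' [h' -> xai' ybj']]]]]] := blowup_pair FH xF yF xy.
rewrite {}xai in xai'; rewrite {}ybj in ybj'.
case/g_inj: xai' ybj' h' => <- <- /g_inj[<- <-] h'.
by rewrite (triple_inj linH h h').
Qed.

(** Adjacent vertices of the blow-up lie over adjacent vertices of [H], so a
    closed walk is a closed walk of [H] with a choice of group coordinates. *)
Lemma closed_walks_blowup k :
  #|closed_walks blowup k| <= #|closed_walks H k| * #|G| ^ k.
Proof.
pose lift (p : k.-tuple V * k.-tuple G) :=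
  [tuple g (tnth p.1 i, tnth p.2 i) | i < k].
have -> : #|closed_walks H k| * #|G| ^ k
    = #|finset.setX (closed_walks H k) [set: k.-tuple G]%SET|.
  by rewrite cardsX cardsT card_tuple.
apply: leq_trans (leq_imset_card lift _).
apply/subset_leq_card/fintype.subsetP => x /closed_walksP xw.
have xE i : exists p q, [/\ tnth x i = g p, tnth x (ordS i) = g q
    & shadow H p.1 q.1].
  have xin : tnth x i \in [set tnth x i; tnth x (ordS i);
    third blowup (tnth x i) (tnth x (ordS i))] by rewrite !inE eqxx.
  have yin : tnth x (ordS i) \in [set tnth x i; tnth x (ordS i);
    third blowup (tnth x i) (tnth x (ordS i))] by rewrite !inE eqxx orbT.
  have [a [b [c [r [s [h _ -> ->]]]]]] :=
    blowup_pair (thirdP (xw i)) xin yin (shadow_neq blowup_linear (xw i)).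
  by exists (a, r), (b, s); split=> //; exact: shadow12 h.
have [f fE] := fin_all_exists xE.
apply/imsetP; exists ([tuple (f i).1 | i < k], [tuple (f i).2 | i < k]).
  rewrite !inE andbT; apply/forallP => i; rewrite !tnth_mktuple.
  have [q [_ xq]] := fE i; have [_ [xf _ _]] := fE (ordS i).
  by move: xq; rewrite xf => /g_inj ->.
apply: eq_from_tnth => i; rewrite !tnth_mktuple -surjective_pairing.
by have [q []] := fE i.
Qed.

Lemma edge_triple e : e \in H -> exists a b c, e = [set a; b; c].
Proof.
move=> /(edge_card linH) e3.
have [a ae] : exists a, a \in e by apply/set0Pn; rewrite -card_gt0 e3.
have /eqP/cards2P[b [c [_ E]]] : #|e :\ a| = 2.
  by move: e3; rewrite (cardsD1 a) ae => -[].
by exists a, b, c; rewrite -(finset.setD1K ae) E finset.setUA.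
Qed.

(** The edges over a fixed edge of [H] are parametrised by two free
    coordinates. *)
Lemma card_blowup : #|H| * #|G| ^ 2 <= #|blowup|.
Proof.
pose proj (E : {set W}) := [set a : V | [exists i, g (a, i) \in E]].
have proj_lift a b c i j : proj (lift3 a b c i j) = [set a; b; c].
  apply/setP => v; rewrite !inE; apply/existsP/idP => [[r]|].
    rewrite !inE !(inj_eq g_inj) !xpair_eqE.
    by case/orP=> [/orP[]|] /andP[-> _]; rewrite ?orbT.
  by case/orP=> [/orP[]|] /eqP ->; [exists i|exists j|exists (- (i + j))%R];
    rewrite !inE eqxx ?orbT.
have projH E : E \in blowup -> proj E \in H.
  by case/blowupP=> [a [b [c [i [j [h ->]]]]]]; rewrite proj_lift.
rewrite -[in leqRHS]sum1_card (partition_big proj (mem H)) //=.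
rewrite -sum_nat_const; apply: leq_sum => e eH.
have [a [b [c E]]] := edge_triple eH; subst e.
have [ab bc ac] := triple_neq linH eH.
have -> : #|G| ^ 2 = #|[set: G * G]%SET| by rewrite cardsT card_prod.
rewrite sum1_card -[leqRHS]cardsE.
apply: (@leq_card_inj _ _ _ _ (fun p => lift3 a b c p.1 p.2)) => [p _|].
  rewrite inE unfold_in proj_lift eqxx andbT.
  by apply/blowupP; exists a, b, c, p.1, p.2.
move=> [i j] [i' j'] _ _ /= E.
have : g (a, i) \in lift3 a b c i' j' by rewrite -E !inE eqxx.
have : g (b, j) \in lift3 a b c i' j' by rewrite -E !inE eqxx orbT.
rewrite !inE !(inj_eq g_inj) !xpair_eqE !eqxx (eq_sym b a).
by rewrite (negbTE ab) (negbTE ac) (negbTE bc) /= !orbF => /eqP -> /eqP ->.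
Qed.

End BlowUp.

(** * Passing to a subsystem with m edges *)

Lemma sub_linear_triple_system (V : finType) (F H : {set {set V}}) :
  F \subset H -> linear_triple_system H -> linear_triple_system F.
Proof.
move=> /fintype.subsetP FH linH; apply/andP; split.
  by apply/forallP => e; apply/implyP => /FH /(edge_card linH) ->.
apply/forallP => x; apply/forallP => y; apply/implyP => xy.
apply/card_le1_eqP => e f; rewrite !inE.
move=> /andP[/FH eH /andP[xe ye]] /andP[/FH fH /andP[xf yf]].
exact: (edge_unique linH fH eH xy xf yf xe ye).
Qed.

Lemma num_copies_sub (V U : finType) (F H : {set {set V}}) (L : {set {set U}}) :
  F \subset H -> num_copies L F <= num_copies L H.
Proof.
move=> FH; apply/subset_leq_card/fintype.subsetP => S; rewrite !inE.
case/andP=> /andP[SF SE] ->; rewrite andbT; apply/andP; split=> //.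
exact: fintype.subset_trans SF FH.
Qed.

Lemma subset_of_card (T : finType) (A : {set T}) (m : nat) :
  m <= #|A| -> exists2 B : {set T}, B \subset A & #|B| = m.
Proof.
rewrite -bin_gt0 -cards_draws card_gt0 => /set0Pn[B].
by rewrite inE => /andP[BA /eqP Bm]; exists B.
Qed.

Lemma blowup_subsystem (t s n m : nat) (H : {set {set 'I_t}}) :
  linear_triple_system H -> 0 < s -> t * s <= n -> m <= #|H| * s ^ 2 ->
  exists F : {set {set 'I_n}}, [/\ linear_triple_system F, #|F| = m
    & num_copies (loose_cycle 5) F <= #|closed_walks H 5| * s ^ 5].
Proof.
case: s => // s linH _ tsn mH.
have card_ts : #|{: 'I_t * 'I_s.+1}| <= n by rewrite card_prod !card_ord.
pose g (p : 'I_t * 'I_s.+1) := widen_ord card_ts (enum_rank p).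
have g_inj : injective g by move=> p q [] /val_inj /enum_rank_inj.
have [F Fsub Fm] : exists2 F : {set {set 'I_n}}, F \subset blowup g H & #|F| = m.
  apply: subset_of_card; apply: leq_trans mH _.
  by have := card_blowup g_inj linH; rewrite card_ord.
exists F; split=> //.
  exact: sub_linear_triple_system Fsub (blowup_linear g_inj linH).
apply: leq_trans (num_copies_sub _ Fsub) _.
apply: leq_trans (num_copies_closed_walks (blowup_linear g_inj linH) _) _.
by have := closed_walks_blowup g_inj linH 5; rewrite card_ord.
Qed.

(** * Numerical estimates *)

Local Open Scope ring_scope.

Section Estimates.
Variable R : realType.

Lemma powR_half (a : R) : 0 <= a -> a `^ (1 / 2) = Num.sqrt a.
Proof. by move=> a0; rewrite div1r powR12_sqrt. Qed.

Lemma powR_three_halves (a : R) : 0 <= a -> a `^ (3 / 2) = Num.sqrt a ^+ 3.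
Proof.
by move=> a0; rewrite mulrC powRrM powR12_sqrt // powR_mulrn ?sqrtr_ge0.
Qed.

(** With q = t^(1/2), degrees are O(q) and triangles O(q^3), and each of the
    terms of [card_closed_walks4] and [card_closed_walks5] is O(q^4); lower
    powers of q are absorbed since q >= 1. *)
Lemma closed_walks5_bound (K : R) (t : nat) (H : {set {set 'I_t}}) :
  0 < K -> (0 < t)%N -> linear_triple_system H ->
  (max_degree H)%:R <= K * t%:R `^ (1 / 2) ->
  (num_copies (loose_cycle 3) H)%:R <= K * t%:R `^ (3 / 2) ->
  (num_copies (loose_cycle 4) H)%:R <= K * t%:R ^+ 2 ->
  (num_copies (loose_cycle 5) H)%:R <= K * t%:R ^+ 2 ->
  #|closed_walks H 5|%:R <= 2 * 10 ^+ 5 * (K ^+ 2 + K) * t%:R ^+ 2.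
Proof.
move=> K0 t0 linH.
rewrite powR_half // powR_three_halves //.
have tE : t%:R = Num.sqrt t%:R ^+ 2 :> R by rewrite sqr_sqrtr.
have q1 : 1 <= Num.sqrt t%:R :> R by rewrite -[leLHS]sqrtr1 ler_sqrt ?ler1n.
move: q1 tE; set q : R := Num.sqrt _ => q1 tE hD h3 h4 h5.
rewrite tE -exprM /= in h4 h5 *.
have q0 : 0 <= q by apply: le_trans q1.
have Kq n : 0 <= K * q ^+ n by rewrite mulr_ge0 ?exprn_ge0 // ltW.
have D0 : 0 <= (max_degree H)%:R :> R by [].
have w3 : #|closed_walks H 3|%:R <= 225 * (K * q ^+ 3).
  have := card_closed_walks3 linH; rewrite -(ler_nat R) card_ord.
  rewrite natrD [X in _ + X]natrM natrX !(natrM, natrD) tE.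
  have : q ^+ 2 * (max_degree H)%:R <= K * q ^+ 3.
    rewrite (_ : K * q ^+ 3 = q ^+ 2 * (K * q)); last by ring.
    by rewrite ler_wpM2l ?exprn_ge0.
  lra.
have w3D : #|closed_walks H 3|%:R * (max_degree H)%:R <= 225 * (K ^+ 2 * q ^+ 4).
  rewrite (_ : 225 * _ = (225 * (K * q ^+ 3)) * (K * q)); last by ring.
  by rewrite ler_pM.
have K4 := Kq 4.
have K24 : 0 <= K ^+ 2 * q ^+ 4 by rewrite mulr_ge0 ?exprn_ge0 // ltW.
have w4 : #|closed_walks H 4|%:R <= 10 ^+ 4 * (K ^+ 2 + K) * q ^+ 4.
  have := card_closed_walks4 linH; rewrite -(ler_nat R) card_ord.
  rewrite natrD [X in _ + X]natrM natrX !(natrM, natrD) tE.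
  have : q ^+ 2 * (max_degree H)%:R * (max_degree H)%:R <= K ^+ 2 * q ^+ 4.
    rewrite (_ : K ^+ 2 * _ = q ^+ 2 * (K * q) * (K * q)); last by ring.
    by rewrite ler_pM ?mulr_ge0 ?exprn_ge0 // ler_wpM2l ?exprn_ge0.
  have : K * q ^+ 3 <= K * q ^+ 4.
    rewrite (_ : K * q ^+ 4 = K * q ^+ 3 * q); last by ring.
    by rewrite ler_peMr.
  lra.
have := card_closed_walks5 linH; rewrite -(ler_nat R).
rewrite natrD [X in _ + X]natrM natrX !(natrM, natrD).
lra.
Qed.

(** Take t = floor (d n^4 / m^2) and s = floor (n / t) with d = c^2 / 16. Since
    s >= n / (2t), the blow-up has at least c n^2 / (4 t^(1/2)) edges, and this
    value of d makes that at least m. Since t >= d n^4 / (2 m^2), also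
    t^2 s^5 <= n^5 / t^3 <= (8 / d^3) m^6 / n^7. The bounds on m in terms of C
    force n0 < t <= n. *)
Lemma blowup_parameters (c L : R) (n0 : nat) : 0 < c -> 0 <= L ->
  exists C : R, 0 < C /\ forall n m : nat, (0 < n)%N ->
    C * n%:R `^ (3 / 2) <= m%:R <= n%:R ^+ 2 / C ->
    exists t s : nat, [/\ (n0 < t)%N, (0 < s)%N, (t * s <= n)%N,
      m%:R <= c * t%:R `^ (3 / 2) * s%:R ^+ 2
      & L * t%:R ^+ 2 * s%:R ^+ 5 <= C * (m%:R ^+ 6 / n%:R ^+ 7)].
Proof.
move=> c0 L0; pose d := c ^+ 2 / 16.
have d0 : 0 < d by rewrite divr_gt0 ?exprn_gt0.
pose C := 1 + d + n0.+1%:R / d + 8 * L / d ^+ 3.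
have A0 : 0 <= n0.+1%:R / d by rewrite divr_ge0 // ltW.
have B0 : 0 <= 8 * L / d ^+ 3 by rewrite divr_ge0 ?exprn_ge0 ?mulr_ge0 // ltW.
have C1 : 1 <= C by rewrite /C; lra.
have dC : d <= C by rewrite /C; lra.
have nC : n0.+1%:R <= d * C by rewrite mulrC -ler_pdivrMr // /C; lra.
have LC : 8 * L <= C * d ^+ 3 by rewrite -ler_pdivrMr ?exprn_gt0 // /C; lra.
have C0 : 0 < C by apply: lt_le_trans C1.
have CC : C <= C ^+ 2 by rewrite expr2 ler_peMr // ltW.
exists C; split=> // n m n0'; rewrite powR_three_halves //.
have pE : n%:R = Num.sqrt n%:R ^+ 2 :> R by rewrite sqr_sqrtr.
have p0 : 0 < Num.sqrt n%:R :> R by rewrite sqrtr_gt0 ltr0n.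
move: p0 pE; set p : R := Num.sqrt _ => p0 pE.
move: (m%:R : R) => M /andP[Mlo Mhi].
have M0 : 0 < M by apply: lt_le_trans Mlo; rewrite mulr_gt0 ?exprn_gt0.
rewrite ler_pdivlMr // pE -exprM /= in Mhi.
pose z := d * p ^+ 8 / M ^+ 2.
have z_ge : n0.+1%:R <= z.
  rewrite ler_pdivlMr ?exprn_gt0 //.
  apply: le_trans (_ : d * C * M ^+ 2 <= _).
    by rewrite ler_wpM2r ?exprn_ge0 // ltW.
  rewrite -mulrA; apply: ler_wpM2l; first exact: ltW.
  apply: le_trans (_ : C ^+ 2 * M ^+ 2 <= _).
    by rewrite ler_wpM2r ?exprn_ge0 // ltW.
  rewrite -exprMn (_ : p ^+ 8 = (p ^+ 4) ^+ 2); last by ring.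
  by rewrite lerXn2r ?nnegrE ?mulr_ge0 ?exprn_ge0 // 1?mulrC // ltW.
have z_le : z <= n%:R.
  rewrite ler_pdivrMr ?exprn_gt0 // pE.
  rewrite (_ : p ^+ 8 = p ^+ 2 * (p ^+ 3) ^+ 2); last by ring.
  rewrite mulrCA; apply: ler_wpM2l; first by rewrite exprn_ge0 // ltW.
  apply: le_trans (_ : (C * p ^+ 3) ^+ 2 <= _).
    rewrite [leRHS]exprMn; apply: ler_wpM2r; last exact: le_trans dC CC.
    by rewrite -exprM exprn_ge0 // ltW.
  by rewrite lerXn2r ?nnegrE ?mulr_ge0 ?exprn_ge0 // ltW.
have z0 : 0 <= z by apply: le_trans z_ge.
have /andP[tz zt] := truncn_itv z0; set t := Num.truncn z in tz zt.
have n0t : (n0 < t)%N by rewrite -ltnS -(ltr_nat R) (le_lt_trans z_ge).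
have t_gt0 : (0 < t)%N by apply: leq_ltn_trans n0t.
have tn : (t <= n)%N by rewrite -(ler_nat R) (le_trans tz).
pose s := (n %/ t)%N.
have s_gt0 : (0 < s)%N by rewrite divn_gt0.
have tsn : (t * s <= n)%N by rewrite mulnC leq_divM.
have n2ts : (n <= 2 * (s * t))%N.
  rewrite (leq_trans (ltnW (ltn_ceil n t_gt0))) // mulnA leq_mul2r -/s.
  by rewrite mul2n -addnn -addn1 leq_add2l s_gt0 orbT.
exists t, s; split=> //.
  rewrite powR_three_halves //.
  have qE : t%:R = Num.sqrt t%:R ^+ 2 :> R by rewrite sqr_sqrtr.
  have q0 : 0 < Num.sqrt t%:R :> R by rewrite sqrtr_gt0 ltr0n.
  move: q0 qE; set q : R := Num.sqrt _ => q0 qE.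
  (* This is t M^2 <= d n^4, with square roots taken. *)
  have qM : 4 * q * M <= c * p ^+ 4.
    have l0 : 0 <= 4 * q * M by rewrite !mulr_ge0 // ltW.
    have r0 : 0 <= c * p ^+ 4 by rewrite mulr_ge0 ?exprn_ge0 // ltW.
    rewrite -ler_sqr ?nnegrE //; have : t%:R * M ^+ 2 <= d * p ^+ 8.
      by rewrite -ler_pdivlMr ?exprn_gt0.
    by rewrite qE /d; lra.
  have p2 : p ^+ 2 <= 2 * (s%:R * q ^+ 2).
    by rewrite -qE -pE -!natrM ler_nat.
  have p4 : p ^+ 4 <= 4 * (s%:R ^+ 2 * q ^+ 4).
    rewrite (_ : p ^+ 4 = (p ^+ 2) ^+ 2); last by ring.
    rewrite (_ : 4 * _ = (2 * (s%:R * q ^+ 2)) ^+ 2); last by ring.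
    by rewrite lerXn2r ?nnegrE ?mulr_ge0 ?exprn_ge0 // ltW.
  rewrite -(@ler_pM2l _ (4 * q)) ?mulr_gt0 //; apply: le_trans qM _.
  rewrite (_ : 4 * q * _ = c * (4 * (s%:R ^+ 2 * q ^+ 4))); last by ring.
  by rewrite ler_wpM2l // ltW.
have T0 : 0 < t%:R :> R by rewrite ltr0n.
have N0 : 0 < n%:R :> R by rewrite ltr0n.
have T1 : 1 <= t%:R :> R by rewrite ler1n.
rewrite [leRHS]mulrA ler_pdivlMr ?exprn_gt0 //.
rewrite -(@ler_pM2l _ (t%:R ^+ 3)) ?exprn_gt0 //.
apply: le_trans (_ : L * n%:R ^+ 12 <= _).
  rewrite [leLHS](_ : _ = L * ((t%:R * s%:R) ^+ 5 * n%:R ^+ 7)); last by ring.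
  rewrite ler_wpM2l // (_ : n%:R ^+ 12 = n%:R ^+ 5 * n%:R ^+ 7); last by ring.
  rewrite ler_wpM2r ?exprn_ge0 // lerXn2r ?nnegrE ?mulr_ge0 ?ler0n //.
  by rewrite -natrM ler_nat.
have tM : d * n%:R ^+ 4 <= 2 * (t%:R * M ^+ 2).
  have : z <= 2 * t%:R by move: zt; rewrite -addn1 natrD; lra.
  by rewrite ler_pdivrMr ?exprn_gt0 // pE -exprM mulrA.
have tM3 : d ^+ 3 * n%:R ^+ 12 <= 8 * (t%:R ^+ 3 * M ^+ 6).
  rewrite (_ : 8 * _ = (2 * (t%:R * M ^+ 2)) ^+ 3); last by ring.
  rewrite (_ : d ^+ 3 * _ = (d * n%:R ^+ 4) ^+ 3); last by ring.
  have l0 : 0 <= d * n%:R ^+ 4 by rewrite mulr_ge0 ?exprn_ge0 // ltW.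
  by rewrite lerXn2r ?nnegrE // (le_trans l0).
rewrite -(@ler_pM2l _ 8) //.
apply: le_trans (_ : C * (d ^+ 3 * n%:R ^+ 12) <= _).
  by rewrite [leLHS]mulrA [leRHS]mulrA ler_wpM2r ?exprn_ge0.
rewrite [leRHS](_ : _ = C * (8 * (t%:R ^+ 3 * M ^+ 6))); last by ring.
by rewrite ler_wpM2l // ltW.
Qed.

End Estimates.

Theorem proposition1p2 (R : realType) (c1 c2 K : R)
  (hc1 : 0 < c1) (hc12 : c1 < c2) (hK : 0 < K)
  (hH : exists n0 : nat, forall n : nat, (n0 <= n)%N ->
    exists H : {set {set 'I_n}},
      [/\ linear_triple_system H,
          c1 * n%:R `^ (3 / 2) <= #|H|%:R <= c2 * n%:R `^ (3 / 2),
          (max_degree H)%:R <= K * n%:R `^ (1 / 2),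
          (num_copies (loose_cycle 3) H)%:R <= K * n%:R `^ (3 / 2)
        & forall k : nat, k = 4%N \/ k = 5%N ->
            (num_copies (loose_cycle k) H)%:R <= K * n%:R ^+ 2]) :
  exists C : R, 0 < C /\
    forall n m : nat,
      C * n%:R `^ (3 / 2) <= m%:R <= n%:R ^+ 2 / C ->
      exists H : {set {set 'I_n}},
        [/\ linear_triple_system H, #|H| = m
          & (num_copies (loose_cycle 5) H)%:R
              <= C * (m%:R ^+ 6 / n%:R ^+ 7)].
Proof.
have [n0 sparse] := hH.
pose L : R := 2 * 10 ^+ 5 * (K ^+ 2 + K).
have L0 : 0 <= L by rewrite mulr_ge0 ?addr_ge0 ?mulr_ge0 ?exprn_ge0 // ltW.
have [C [C0 params]] := blowup_parameters n0 hc1 L0.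
exists C; split=> // n m; have [->|n_gt0] := posnP n.
  (* Here m = 0, and the bound m^6 / n^7 is 0 / 0 = 0. *)
  rewrite expr0n mul0r => /andP[_]; rewrite lern0 => /eqP ->.
  have lin0 : linear_triple_system (finset.set0 : {set {set 'I_0}}).
    apply/andP; split; first by apply/forallP => e; rewrite inE.
    by apply/forallP => -[].
  exists finset.set0; split; rewrite ?cards0 //.
  apply: le_trans (_ : 0 <= _); last first.
    by rewrite mulr_ge0 ?divr_ge0 ?exprn_ge0 // ltW.
  rewrite lern0 -leqn0.
  apply: leq_trans (num_copies_closed_walks lin0 5) _.
  by rewrite (leq_trans (max_card _)) // card_tuple card_ord.
case/(params _ _ n_gt0) => t [s [n0t s0 tsn mts bound]].
have [H [linH /andP[Hlo _] hD h3 h45]] := sparse t (ltnW n0t).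
have mH : (m <= #|H| * s ^ 2)%N.
  rewrite -(ler_nat R) natrM natrX (le_trans mts) //.
  by rewrite ler_wpM2r ?exprn_ge0.
have [F [linF Fm FC]] := blowup_subsystem linH s0 tsn mH.
exists F; split=> //; apply: le_trans bound.
move: FC; rewrite -(ler_nat R) natrM natrX => FC; apply: le_trans FC _.
rewrite ler_wpM2r ?exprn_ge0 // closed_walks5_bound //.
- exact: leq_ltn_trans n0t.
- by apply: h45; left.
- by apply: h45; right.
Qed.
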